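(* Let $G$ be a distance-regular graph with $n$ vertices, diameter $3$, intersection array $\{k,b_1,b_2;1,c_2,c_3\}$ and distinct adjacency eigenvalues $k>\theta_1>\theta_2>\theta_3$. Put $a_3=k-c_3$ and, for $l\in\{1,2,3\}$, $q_l=\frac{\theta_l-a_3+b_2}{c_2}$. Let $q\neq 0$ be a real number and let $\mathbb{D}_q=\mathbb{D}_q(G)$ be the $q$-distance matrix of $G$. (i) If $q\notin\{q_1,q_2,q_3\}$ and $q\notin(-1,0]$, then $\mathbb{D}_q$ has exactly four distinct eigenvalues. (ii) If $q\notin\{q_1,q_2,q_3\}$ and $q\in(-1,0)$, then $\mathbb{D}_q$ has at least three distinct eigenvalues. (iii) If $q\in\{q_1,q_2,q_3\}$ and $q\notin(-1,0]$, then $\mathbb{D}_q$ has exactly three distinct eigenvalues. (iv) If $q\in\{q_1,q_2,q_3\}$ and $q\in(-1,0)$, then $\mathbb{D}_q$ has at least two and at most three distinct eigenvalues.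
   Context: Graphs are finite, undirected and simple. A connected graph $G$ of diameter $D$ is distance-regular if there are numbers $a_i,b_i,c_i$ ($0\le i\le D$) such that for all vertices $x,y$ with $d(x,y)=i$, the number of neighbours of $y$ at distance $i-1$, $i$, $i+1$ from $x$ is $c_i$, $a_i$, $b_i$ respectively; $k=b_0$ is the valency, $c_0=b_D=0$, $a_i+b_i+c_i=k$, and $\{b_0,\dots,b_{D-1};c_1=1,c_2,\dots,c_D\}$ is the intersection array. For real $q\ne0$, the $q$-distance matrix $\mathbb{D}_q(G)$ is indexed by $V(G)$, with $(\mathbb{D}_q(G))_{xy}=1+\frac1q+\cdots+\frac1{q^{d-1}}$ if $d(x,y)=d\ge1$ and $(\mathbb{D}_q(G))_{xx}=0$. *)

(* Defs.v *)
From HB Require Import structures.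
From mathcomp Require Import all_boot all_order all_algebra.
From mathcomp Require Import reals.

Set Implicit Arguments.
Unset Strict Implicit.
Unset Printing Implicit Defensive.

Import Order.TTheory GRing.Theory Num.Theory.
Local Open Scope ring_scope.

Record sgraph := SGraph {
  vertex :> finType;
  adj : rel vertex;
  adj_sym : symmetric adj;
  adj_irr : irreflexive adj }.

Definition connected_graph (G : sgraph) : Prop :=
  forall x y : G, connect (@adj G) x y.

Definition walk (G : sgraph) (m : nat) (x y : G) : bool :=
  [exists p : m.-tuple G, path (@adj G) x p && (last x p == y)].

(* The length of a shortest walk from x to y. A shortest walk repeats no
   vertex, so lengths below #|G| suffice; the value is #|G| when y is not
   reachable from x. *)
Definition dist (G : sgraph) (x y : G) : nat :=
  find (fun m => walk m x y) (iota 0 #|G|).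

Definition diameter (G : sgraph) : nat :=
  (\max_(x : G) \max_(y : G) dist x y)%N.

(* Only the values at indices 0 <= i <= diameter G are constrained. The
   equations force c 0 = 0 and b (diameter G) = 0. *)
Definition intersection_numbers (G : sgraph) (a b c : nat -> nat) : Prop :=
  forall (x y : G) (i : nat), dist x y = i ->
    [/\ #|[set z : G | adj y z && ((dist x z).+1 == i)]| = c i,
        #|[set z : G | adj y z && (dist x z == i)]| = a i
      & #|[set z : G | adj y z && (dist x z == i.+1)]| = b i].

Definition distance_regular (G : sgraph) : Prop :=
  connected_graph G /\ exists a b c, @intersection_numbers G a b c.

(* bs = [b_0; ...; b_(D-1)] and cs = [c_1; ...; c_D], D the diameter. *)
Definition intersection_array (G : sgraph) (bs cs : seq nat) : Prop :=
  exists a b c, [/\ @intersection_numbers G a b c,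
                    bs = mkseq b (diameter G)
                  & cs = mkseq (fun i => c i.+1) (diameter G)].

Definition adjacency_mx (R : realType) (G : sgraph) : 'M[R]_#|G| :=
  \matrix_(i, j) (adj (enum_val i) (enum_val j))%:R.

(* The entry at distance d is 1 + 1/q + ... + 1/q^(d-1), the empty sum on
   the diagonal. *)
Definition q_distance_mx (R : realType) (G : sgraph) (q : R) : 'M[R]_#|G| :=
  \matrix_(i, j) \sum_(m < dist (enum_val i) (enum_val j)) q ^- m.

(* s lists every eigenvalue of M exactly once. *)
Definition distinct_eigenvalues (R : realType) (n : nat) (M : 'M[R]_n)
    (s : seq R) : Prop :=
  uniq s /\ forall t : R, eigenvalue M t = (t \in s).

(* Main.v *)
Require Import Defs.
From mathcomp Require Import all_boot all_order all_algebra.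
From mathcomp Require Import reals ring lra.

Set Implicit Arguments.
Unset Strict Implicit.
Unset Printing Implicit Defensive.

Import Order.TTheory GRing.Theory Num.Theory.
Local Open Scope ring_scope.

(** Write [A] for the adjacency matrix, [A2], [A3] for the distance matrices and
    [J] for the all-ones matrix.  Since [A * A = k + a1 A + c2 A2] with [c2 > 0]
    and [1 + A + A2 + A3 = J], the matrix [Dq] is a combination of [J], [1], [A]
    and [A * A].  Hence the all-ones vector is an eigenvector of [Dq], for its row
    sum, and on the complement of that vector [Dq] acts as a quadratic polynomial
    [f] in [A].

    The relation [A3 * A = b2 A2 + a3 A3] then makes a monic cubic in [A] equal to
    a multiple of [J] (lemma [adjacency_cubic]).  Its roots must be the three
    nontrivial eigenvalues of [A], so the cubic is their product of linear factors
    and every eigenvector of [Dq] with coordinate sum 0 leads to a common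
    eigenvector of [A] and [Dq] (lemma [eigenvalue_factors3]).  The spectrum of
    [Dq] is thus the row sum together with the values [f theta_i]
    (lemma [q_distance_spectrum]).

    It remains to see which of these four numbers agree.  The difference
    [f x - f y] is [x - y] times a nonzero multiple of [q - (a1 - c2 - x - y) / c2],
    and Vieta's formula for the sum of the three roots turns the constant into the
    value [q_l] of the third eigenvalue (lemma [q_eigenvalue_eq]).  As the [q_l] are
    distinct, at most one pair of values coincides, and one does exactly when [q]
    is some [q_l].  If [q > 0] or [q <= -1], then [Dq] is entrywise nonnegative and
    irreducible, and by Perron's argument the row sum is different from each
    [f theta_i] (lemmas [perron_constant] and [q_trivial_eigenvalue_simple]). *)

(** * Distances in a connected graph *)

Section Distance.
Variable G : sgraph.
Implicit Types x y z : G.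
Local Open Scope nat_scope.

Lemma walkP m x y :
  reflect (exists p, [/\ size p = m, path (@adj G) x p & last x p = y])
          (walk m x y).
Proof.
apply: (iffP existsP) => [[p /andP[xp /eqP]]|[p [sp xp lp]]].
  by exists p; rewrite size_tuple.
by exists (tcast sp (in_tuple p)); rewrite !val_tcast /= xp lp eqxx.
Qed.

Lemma walk0 x y : walk 0 x y = (x == y).
Proof.
apply/walkP/eqP => [[p [/size0nil-> _ /=]] //|->].
by exists [::].
Qed.

Lemma walkSP m x z :
  reflect (exists2 y, walk m x y & adj y z) (walk m.+1 x z).
Proof.
apply: (iffP idP) => [/walkP[p]|[y /walkP[p [sp xp lp]] yz]].
  case/lastP: p => [|p w] [] //; rewrite size_rcons last_rcons rcons_path.
  case=> sp /andP[xp pw] <-; exists (last x p) => //.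
  by apply/walkP; exists p.
apply/walkP; exists (rcons p z).
by rewrite size_rcons last_rcons rcons_path sp xp lp.
Qed.

Lemma dist_le m x y : walk m x y -> dist x y <= m.
Proof.
move=> w; rewrite leqNgt; apply/negP => lt_m.
have /(before_find 0) := lt_m; rewrite nth_iota ?add0n ?w //.
by apply: leq_trans lt_m _; rewrite -[X in _ <= X](size_iota 0) find_size.
Qed.

Hypothesis G_conn : connected_graph G.

(** A shortest walk repeats no vertex, so its length is below the bound up to
    which [dist] searches. *)
Lemma walk_dist x y : walk (dist x y) x y.
Proof.
have /connectP[p0 xp0 ->] := G_conn x y.
case/shortenP: xp0 => p xp up _.
have pG : size p < #|G| by rewrite -[(size p).+1](card_uniqP up) max_card.
have hasw : has (fun m => walk m x (last x p)) (iota 0 #|G|).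
  apply/hasP; exists (size p); first by rewrite mem_iota add0n.
  by apply/walkP; exists p.
have := nth_find 0 hasw; rewrite nth_iota ?add0n //.
by move: hasw; rewrite has_find size_iota.
Qed.

Lemma dist_eq0 x y : (dist x y == 0) = (x == y).
Proof.
apply/idP/idP => [/eqP d0|xy]; first by have := walk_dist x y; rewrite d0 walk0.
by rewrite -leqn0 dist_le // walk0.
Qed.

Lemma dist_adj_le x y z : adj y z -> dist x z <= (dist x y).+1.
Proof. by move=> yz; apply/dist_le/walkSP; exists y => //; apply: walk_dist. Qed.

Lemma dist_eq1 x y : (dist x y == 1) = adj x y.
Proof.
apply/idP/idP => [/eqP d1|xy].
  by have := walk_dist x y; rewrite d1 => /walkSP[z]; rewrite walk0 => /eqP->.
have le1 : dist x y <= 1 by apply/dist_le/walkSP; exists x; rewrite ?walk0.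
rewrite eqn_leq le1 lt0n dist_eq0.
by apply: contraTneq xy => ->; rewrite adj_irr.
Qed.

Lemma dist_pred x z d :
  dist x z = d.+1 -> exists2 y, dist x y = d & adj y z.
Proof.
move=> dz; have := walk_dist x z; rewrite dz => /walkSP[y w yz].
exists y => //; apply/eqP; rewrite eqn_leq dist_le //=.
by rewrite -ltnS -dz dist_adj_le.
Qed.

Lemma dist_le_diameter x y : dist x y <= diameter G.
Proof. by apply: (bigop.bigmax_sup x) => //; apply: (bigop.bigmax_sup y). Qed.

Lemma diameter_attained : 0 < diameter G -> exists x y, dist x y = diameter G.
Proof.
move=> D_gt0; have G_gt0 : 0 < #|G|.
  rewrite lt0n; apply: contraL D_gt0 => /eqP/card0_eq G0.
  by rewrite /diameter big_pred0.
have [x Ex] := bigop.eq_bigmax (fun x => \max_(y : G) dist x y) G_gt0.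
have [y Ey] := bigop.eq_bigmax (fun y => dist x y) G_gt0.
by exists x, y; rewrite /diameter Ex Ey.
Qed.

End Distance.

(** * Eigenvectors with coordinate sum zero *)

Section PolynomialInA.
Variables (F : fieldType) (n : nat).
Implicit Types (A D : 'M[F]_n) (v : 'rV[F]_n).
Local Notation J := (const_mx 1 : 'M[F]_n).

Lemma const_mx_mul (m r : nat) :
  (const_mx 1 : 'M[F]_(m, n)) *m (const_mx 1 : 'M_(n, r)) = n%:R *: const_mx 1.
Proof.
apply/matrixP => i j; rewrite !mxE (eq_bigr (fun=> 1)) => [|l _].
  by rewrite sumr_const card_ord mulr1.
by rewrite !mxE mulr1.
Qed.

(** Eigenvectors for different eigenvalues on the left and on the right are
    orthogonal; here the right eigenvector is the all-ones vector. *)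
Lemma eigenvector_sum0 A k theta v :
  A *m J = k *: J -> theta != k -> v *m A = theta *: v -> v *m J = 0.
Proof.
move=> AJ neq vA; have : (theta - k) *: (v *m J) = 0.
  by rewrite scalerBl [theta *: _]scalemxAl -vA -mulmxA AJ scalemxAr subrr.
by move/eqP; rewrite scaler_eq0 subr_eq0 (negPf neq) => /eqP.
Qed.

(** Apply the three factors to [v] one after another.  Every vector on the way
    stays in the [t]-eigenspace of [D], because [A] and [D] commute, and the last
    nonzero one is an eigenvector of [A].  This replaces simultaneous
    diagonalization. *)
Lemma eigenvalue_factors3 A D (k t x y z : F) v :
    A *m J = k *: J -> A *m D = D *m A -> v != 0 -> v *m D = t *: v -> v *m J = 0 ->
    v *m ((A - x%:M) *m (A - y%:M) *m (A - z%:M)) = 0 ->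
  exists (w : 'rV_n) theta, [/\ theta \in [:: x; y; z], w != 0, w *m A = theta *: w,
    w *m D = t *: w & w *m J = 0].
Proof.
move=> AJ AD v0 vD vJ.
pose next (u : 'rV_n) s := u *m (A - s%:M).
have next0 u s : next u s = 0 -> u *m A = s *: u.
  by move/eqP; rewrite /next mulmxBr mul_mx_scalar subr_eq0 => /eqP.
have nextJ u s : u *m J = 0 -> next u s *m J = 0.
  move=> uJ; rewrite /next mulmxBr mul_mx_scalar mulmxBl -mulmxA AJ -scalemxAr.
  by rewrite -scalemxAl uJ !scaler0 subr0.
have nextD u s : u *m D = t *: u -> next u s *m D = t *: next u s.
  move=> uD; rewrite /next mulmxBr mul_mx_scalar mulmxBl -mulmxA AD mulmxA uD.
  by rewrite -!scalemxAl uD scalerBr !scalerA mulrC.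
rewrite !mulmxA -/(next v x) -/(next _ y) -/(next _ z) => v3.
have [/next0 vA|v1] := eqVneq (next v x) 0.
  by exists v, x; rewrite mem_head.
have [/next0 vA|v2] := eqVneq (next (next v x) y) 0.
  by exists (next v x), y; split; rewrite ?inE ?eqxx ?orbT //; auto.
exists (next (next v x) y), z.
by split; rewrite ?inE ?eqxx ?orbT //; auto.
Qed.

End PolynomialInA.

(** * Perron's argument *)

Section Perron.
Variables (R : realDomainType) (n : nat).

(** At a maximal coordinate [v i], the eigenvalue equation writes [v i] as a
    weighted average of coordinates, so those with positive weight are
    maximal too; connectedness spreads the maximum everywhere. *)
Lemma perron_constant (M : 'M[R]_n) (lambda : R) (v : 'rV[R]_n) :
    (forall i j, 0 <= M i j) ->
    (const_mx 1 : 'rV_n) *m M = lambda *: const_mx 1 ->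
    (forall i j, connect [rel i j | 0 < M j i] i j) ->
    v *m M = lambda *: v ->
  forall i j, v 0 i = v 0 j.
Proof.
move=> M_ge0 M1 M_conn vM i.
have [m /= _ m_max] := arg_maxP (v 0) (erefl : predT i).
suff vm j : v 0 j = v 0 m by move=> j; rewrite !vm.
have /connectP[p] := M_conn m j.
elim/last_ind: p j => [|p w IHp] j; first by move=> _ ->.
rewrite rcons_path last_rcons => /andP[mp /=]; move: (IHp _ mp erefl).
set l := last m p => vl Mwl ->.
(* The column sums are [lambda], so the total deficit below the maximum is 0. *)
have sum0 : \sum_j0 (v 0 m - v 0 j0) * M j0 l = 0.
  have Ml : \sum_j0 M j0 l = lambda.
    have /rowP/(_ l) := M1; rewrite !mxE mulr1 => <-.
    by apply: eq_bigr => j0 _; rewrite mxE mul1r.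
  have /rowP/(_ l) := vM; rewrite !mxE vl => vMl.
  under eq_bigr do rewrite mulrBl.
  by rewrite sumrB vMl -mulr_sumr Ml mulrC subrr.
have /psumr_eq0P/(_ sum0 w isT)/eqP : forall j0, true ->
    0 <= (v 0 m - v 0 j0) * M j0 l.
  by move=> j0 _; rewrite mulr_ge0 // subr_ge0 m_max.
by rewrite mulf_eq0 subr_eq0 (gt_eqF Mwl) orbF => /eqP.
Qed.

End Perron.

(** * The cubic relation for the adjacency matrix *)

(** Divided differences of the three equations give first the sum of the roots,
    then the other coefficients. *)
Lemma cubic_vieta (F : fieldType) (s t r x y z : F) :
    x != y -> x != z -> y != z ->
    (forall u, u \in [:: x; y; z] -> u ^+ 3 + s * u ^+ 2 + t * u + r = 0) ->
  [/\ s = - (x + y + z), t = x * y + x * z + y * z & r = - (x * y * z)].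
Proof.
move=> xy xz yz P0.
have Px := P0 x (mem_head _ _).
have Py : y ^+ 3 + s * y ^+ 2 + t * y + r = 0 by rewrite P0 ?inE ?eqxx ?orbT.
have Pz : z ^+ 3 + s * z ^+ 2 + t * z + r = 0 by rewrite P0 ?inE ?eqxx ?orbT.
have div_diff u w : u != w ->
    u ^+ 3 + s * u ^+ 2 + t * u + r = 0 -> w ^+ 3 + s * w ^+ 2 + t * w + r = 0 ->
    u ^+ 2 + u * w + w ^+ 2 + s * (u + w) + t = 0.
  rewrite -subr_eq0 => uw Pu Pw; apply: (mulfI uw); rewrite mulr0.
  by rewrite -(subrr 0) -{1}Pu -Pw; ring.
have Qxy := div_diff _ _ xy Px Py; have Qxz := div_diff _ _ xz Px Pz.
have Es : s = - (x + y + z).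
  have yz0 : y - z != 0 by rewrite subr_eq0.
  apply/eqP; rewrite -subr_eq0 opprK; apply/eqP; apply: (mulfI yz0).
  by rewrite mulr0 -(subrr 0) -{1}Qxy -Qxz; ring.
have Et : t = x * y + x * z + y * z.
  apply/eqP; rewrite -subr_eq0; apply/eqP; rewrite -Qxy Es; ring.
split=> //; apply/eqP; rewrite -subr_eq0; apply/eqP; rewrite -Px Es Et; ring.
Qed.

Section Relations.
Variables (F : fieldType) (n : nat) (A A2 A3 : 'M[F]_n) (k a1 b2 c2 a3 : F).
Local Notation J := (const_mx 1 : 'M[F]_n).
Hypotheses (AA : A *m A = k%:M + a1 *: A + c2 *: A2)
  (A3A : A3 *m A = b2 *: A2 + a3 *: A3)
  (sumA : 1%:M + A + A2 + A3 = J) (JA : J *m A = k *: J).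

(** Substituting [A3 = J - 1 - A - A2] in [A3 * A = b2 A2 + a3 A3], and then
    [c2 A2 = A * A - k - a1 A], leaves a relation between powers of [A] and [J].
    The coefficients are those of
    [(X - a3) (c2 + c2 X + X^2 - a1 X - k) + b2 (X^2 - a1 X - k)]. *)
Lemma adjacency_cubic :
  A *m A *m A + (c2 - a1 - a3 + b2) *: (A *m A)
    + (c2 - k - a3 * (c2 - a1) - a1 * b2) *: A
    + (- a3 * (c2 - k) - k * b2) *: 1%:M = (c2 * (k - a3)) *: J.
Proof.
have c2A2 : c2 *: A2 = A *m A - k *: 1%:M - a1 *: A.
  by rewrite AA scalemx1; apply/matrixP => i j; rewrite !mxE; ring.
have c2A2A : c2 *: (A2 *m A) = A *m A *m A - k *: A - a1 *: (A *m A).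
  by rewrite scalemxAl c2A2 !mulmxBl -!scalemxAl mul1mx.
have EA3 : A3 = J - 1%:M - A - A2.
  by rewrite -sumA; apply/matrixP => i j; rewrite !mxE; ring.
have := A3A; rewrite EA3 !mulmxBl JA mul1mx.
move: c2A2 c2A2A; move: (A2 *m A) (A *m A) (A *m A *m A) => U W2 W3.
move=> /matrixP c2A2 /matrixP c2U /matrixP E; apply/matrixP => i j.
move: (c2A2 i j) (c2U i j) (E i j); rewrite !mxE.
move: (W3 i j) (W2 i j) (U i j) (A i j) (A2 i j) ((i == j)%:R : F).
move=> w3 w2 u a a' d.
move=> /eqP; rewrite -subr_eq0 => /eqP Ea'.
move=> /eqP; rewrite -subr_eq0 => /eqP Eu.
move=> /eqP; rewrite -subr_eq0 => /eqP E0.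
(* The difference of the two sides as a combination of the three equations. *)
apply/eqP; rewrite -subr_eq0; apply/eqP.
transitivity (- c2 * 0 - 0 + (a3 - b2) * 0 : F); last by ring.
by rewrite -{1}E0 -{1}Eu -Ea'; ring.
Qed.

End Relations.

(** * Quadratic polynomials in the adjacency matrix modulo J *)

Section Spectrum.
Variables (F : fieldType) (n : nat) (A : 'M[F]_n) (k g p0 p1 p2 : F).
Local Notation J := (const_mx 1 : 'M[F]_n).
Local Notation "A ^2" := (A *m A) (at level 8, format "A ^2").
Hypotheses (AJ : A *m J = k *: J) (JA : J *m A = k *: J).

Definition quadratic_mx : 'M[F]_n := g *: J + p0 *: 1%:M + p1 *: A + p2 *: A^2.
(** The eigenvalue of [quadratic_mx] at the all-ones vector, on which [J] acts as
    [n] and [A] as [k]. *)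
Definition trivial_value : F := g * n%:R + p0 + p1 * k + p2 * k ^+ 2.
(** The eigenvalue of [quadratic_mx] at an eigenvector of [A] that [J] kills. *)
Definition nontrivial_value (theta : F) : F := p0 + p1 * theta + p2 * theta ^+ 2.
Local Notation D := quadratic_mx.

Lemma quadratic_comm : A *m D = D *m A.
Proof.
rewrite !mulmxDr !mulmxDl -!scalemxAr -!scalemxAl AJ JA mul1mx mulmx1.
by rewrite !mulmxA.
Qed.

Lemma quadratic_mulJ : D *m J = trivial_value *: J.
Proof.
rewrite !mulmxDl -!scalemxAl mul1mx -mulmxA AJ -!scalemxAr AJ const_mx_mul.
by rewrite !scalerA -!scalerDl /trivial_value expr2 mulrA.
Qed.

Lemma quadratic_Jmul : J *m D = trivial_value *: J.
Proof.
rewrite !mulmxDr -!scalemxAr mulmx1 mulmxA JA -!scalemxAl JA const_mx_mul.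
by rewrite !scalerA -!scalerDl /trivial_value expr2 mulrA.
Qed.

Lemma quadratic_eigenvector theta (v : 'rV_n) :
  v *m J = 0 -> v *m A = theta *: v -> v *m D = nontrivial_value theta *: v.
Proof.
move=> vJ vA; rewrite !mulmxDr -!scalemxAr vJ scaler0 add0r mulmx1 mulmxA vA.
by rewrite -!scalemxAl vA !scalerA -!scalerDl /nontrivial_value expr2 mulrA.
Qed.

Lemma const_row_mul (M : 'M[F]_n) (lambda : F) : (0 < n)%N ->
  J *m M = lambda *: J -> (const_mx 1 : 'rV_n) *m M = lambda *: const_mx 1.
Proof.
move=> n_gt0 /matrixP JM; apply/rowP => j.
move: (JM (Ordinal n_gt0) j); rewrite !mxE => <-.
by apply: eq_bigr => l _; rewrite !mxE.
Qed.

(** For an eigenvector [v] of the eigenvalue [t], either [v J] is nonzero, and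
    comparing [v D J] computed in two ways gives [t = trivial_value]; or [v J = 0],
    and the three factors annihilate [v]. *)
Lemma quadratic_spectrum (x y z h : F) : (0 < n)%N ->
    {in [:: x; y; z], forall theta, eigenvalue A theta /\ theta != k} ->
    (A - x%:M) *m (A - y%:M) *m (A - z%:M) = h *: J ->
  forall t, eigenvalue D t =
    (t \in trivial_value :: [seq nontrivial_value theta | theta <- [:: x; y; z]]).
Proof.
move=> n_gt0 eigA hoffman t; apply/idP/idP.
  case/eigenvalueP => v vD v0; rewrite inE.
  have [vJ|vJ] := eqVneq (v *m J) 0.
    apply/orP; right.
    have [|w [theta [theta_in w0 wA wD wJ]]] :=
      eigenvalue_factors3 (x := x) (y := y) (z := z) AJ quadratic_comm v0 vD vJ.
      by rewrite hoffman -scalemxAr vJ scaler0.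
    apply/mapP; exists theta => //.
    have /eqP := quadratic_eigenvector wJ wA.
    by rewrite wD -subr_eq0 -scalerBl scaler_eq0 (negPf w0) orbF subr_eq0 => /eqP.
  apply/orP; left; rewrite -subr_eq0.
  have : (t - trivial_value) *: (v *m J) == 0.
    by rewrite scalerBl [t *: _]scalemxAl -vD -mulmxA quadratic_mulJ -scalemxAr subrr.
  by rewrite scaler_eq0 (negPf vJ) orbF.
rewrite inE => /orP[/eqP->|/mapP[theta /eigA[/eigenvalueP[v vA v0] thk] ->]].
  apply/eigenvalueP; exists (const_mx 1).
    by apply: const_row_mul => //; apply: quadratic_Jmul.
  apply/eqP => /rowP/(_ (Ordinal n_gt0)); rewrite !mxE.
  by apply/eqP; apply: oner_neq0.
apply/eigenvalueP; exists v => //; apply: quadratic_eigenvector => //.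
exact: eigenvector_sum0 AJ thk vA.
Qed.

End Spectrum.

(** * Distance matrices of a graph of diameter three *)

Section DiameterThree.
Variables (R : realType) (G : sgraph) (a b c : nat -> nat).
Hypotheses (G_conn : connected_graph G) (G_diam : diameter G = 3%N)
  (abc : @intersection_numbers G a b c).

Local Notation n := #|G|.
Local Notation J := (const_mx 1 : 'M[R]_n).

Definition dist_mx (d : nat) : 'M[R]_n :=
  \matrix_(i, j) (dist (enum_val i) (enum_val j) == d)%:R.

Local Notation A := (adjacency_mx R G).
Local Notation k := ((b 0)%:R : R).

Lemma sum_enum_val (f : G -> R) : \sum_(i < n) f (enum_val i) = \sum_x f x.
Proof. by rewrite [RHS](reindex _ (onW_bij _ (@enum_val_bij G))). Qed.

Lemma dist_le3 (x y : G) : (dist x y <= 3)%N.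
Proof. by rewrite -G_diam dist_le_diameter. Qed.

Lemma dist_mx1 : dist_mx 1 = A.
Proof. by apply/matrixP => i j; rewrite !mxE dist_eq1. Qed.

Lemma dist_mx_sum : 1%:M + A + dist_mx 2 + dist_mx 3 = J.
Proof.
apply/matrixP => i j; rewrite !mxE -dist_eq1 // -(inj_eq enum_val_inj) -dist_eq0 //.
by case: dist (dist_le3 (enum_val i) (enum_val j)) => [|[|[|[|m]]]] //= _;
  rewrite ?(addr0, add0r).
Qed.

(** Products with [A] count neighbours at a given distance, which is what the
    intersection numbers measure. *)
Lemma dist_mx_mulA d i j : (dist_mx d *m A) i j =
  #|[set z : G | adj (enum_val j) z && (dist (enum_val i) z == d)]|%:R.
Proof.
rewrite mxE -sum1_card natr_sum [RHS]big_mkcond /=.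
rewrite -sum_enum_val; apply: eq_bigr => l _.
rewrite !mxE inE adj_sym -natrM mulnb andbC.
by case: ifP.
Qed.

Lemma dist_adj_bounds (x y z : G) d :
  adj y z -> dist x z = d -> (dist x y <= d.+1 <= (dist x y).+2)%N.
Proof.
by move=> yz <-; rewrite ltnS !dist_adj_le // adj_sym.
Qed.

Lemma dist_mx1_mulA : A *m A = k%:M + (a 1)%:R *: A + (c 2)%:R *: dist_mx 2.
Proof.
rewrite -{1}dist_mx1; apply/matrixP => i j; rewrite dist_mx_mulA !mxE.
rewrite -(inj_eq enum_val_inj) -dist_eq1 // -dist_eq0 //.
set x := enum_val i; set y := enum_val j.
have [] := abc (erefl (dist x y)).
case Exy: (dist x y) (dist_le3 x y) => [|[|[|[|m]]]] //= _.
- by move=> _ _ ->; rewrite !mulr0 !addr0.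
- by move=> _ -> _; rewrite mulr1 mulr0 addr0 add0r.
- by under eq_finset => z do rewrite eqSS; move=> -> _ _; rewrite mulr1 mulr0 !add0r.
- move=> _ _ _; rewrite !mulr0 !addr0 (_ : [set _ | _] = set0) ?cards0 //.
  apply/setP => z; rewrite !inE; apply/negP => /andP[yz /eqP xz].
  by have := dist_adj_bounds yz xz; rewrite Exy.
Qed.

Lemma dist_mx3_mulA :
  dist_mx 3 *m A = (b 2)%:R *: dist_mx 2 + (a 3)%:R *: dist_mx 3.
Proof.
apply/matrixP => i j; rewrite dist_mx_mulA !mxE.
set x := enum_val i; set y := enum_val j.
have [] := abc (erefl (dist x y)).
case Exy: (dist x y) (dist_le3 x y) => [|[|[|[|m]]]] //= _.
- move=> _ _ _; rewrite !mulr0 !addr0 (_ : [set _ | _] = set0) ?cards0 //.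
  apply/setP => z; rewrite !inE; apply/negP => /andP[yz /eqP xz].
  by have := dist_adj_bounds yz xz; rewrite Exy.
- move=> _ _ _; rewrite !mulr0 !addr0 (_ : [set _ | _] = set0) ?cards0 //.
  apply/setP => z; rewrite !inE; apply/negP => /andP[yz /eqP xz].
  by have := dist_adj_bounds yz xz; rewrite Exy.
- by move=> _ _ ->; rewrite mulr1 mulr0 addr0.
- by move=> _ -> _; rewrite mulr1 mulr0 add0r.
Qed.

Lemma degree (x : G) : #|[set z | adj x z]| = b 0.
Proof.
have /eqP dxx : dist x x == 0%N by rewrite dist_eq0.
have [_ _ <-] := abc dxx; apply: eq_card => z.
by rewrite !inE dist_eq1 // andbb.
Qed.

Lemma adjacency_mulJ : A *m J = k *: J.
Proof.
apply/matrixP => i j; rewrite !mxE mulr1 -(degree (enum_val i)).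
rewrite -sum1_card natr_sum [RHS]big_mkcond -sum_enum_val /=; apply: eq_bigr => l _.
by rewrite !mxE inE mulr1; case: adj.
Qed.

Lemma adjacency_Jmul : J *m A = k *: J.
Proof.
have trA : A^T = A by apply/matrixP => i j; rewrite !mxE adj_sym.
by rewrite -[LHS]trmxK trmx_mul trA trmx_const adjacency_mulJ linearZ /= trmx_const.
Qed.

(** At two vertices at distance 3, no neighbour can be farther than 3. *)
Lemma valency_split : (a 3 + c 3 = b 0)%N.
Proof.
have [|x [y xy]] := @diameter_attained G; first by rewrite G_diam.
rewrite G_diam in xy; have [<- <- _] := abc xy; rewrite -(degree y).
rewrite -cardsUI [X in (_ + X)%N](_ : _ = 0%N); last first.
  apply/eqP; rewrite cards_eq0; apply/eqP/setP => z; rewrite !inE.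
  by case: adj; case: dist => [|[|[|[|m]]]].
rewrite addn0; apply: eq_card => z; rewrite !inE -andb_orr.
case yz: (adj y z) => //=.
have := dist_adj_bounds yz (erefl (dist x z)); rewrite xy.
by case: dist (dist_le3 x z) => [|[|[|[|m]]]].
Qed.

(** A shortest path of length 3 passes through a vertex at distance 2 from its
    start, and its predecessor on the path is counted by [c 2]. *)
Lemma c2_gt0 : (0 < c 2)%N.
Proof.
have [|x [y xy]] := @diameter_attained G; first by rewrite G_diam.
rewrite G_diam in xy; have [z xz _] := dist_pred G_conn xy.
have [w xw wz] := dist_pred G_conn xz.
have [<- _ _] := abc xz; apply/card_gt0P; exists w.
by rewrite inE adj_sym wz xw.
Qed.

Lemma card_gt0 : (0 < n)%N.
Proof.
have [|x _] := @diameter_attained G; first by rewrite G_diam.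
by apply/card_gt0P; exists x.
Qed.

End DiameterThree.

(** * The q-distance matrix *)

Section QDistance.
Variables (R : realType) (G : sgraph) (q : R).
Hypotheses (G_conn : connected_graph G) (G_diam : diameter G = 3%N).
Local Notation n := #|G|.
Local Notation Dq := (q_distance_mx G q).

Lemma q_distance_mxE : Dq =
  adjacency_mx R G + (1 + q^-1) *: dist_mx R G 2
    + (1 + q^-1 + q ^- 2) *: dist_mx R G 3.
Proof.
apply/matrixP => i j; rewrite !mxE -dist_eq1 //.
case: dist (dist_le3 G_diam (enum_val i) (enum_val j)) => [|[|[|[|m]]]] //= _;
  by rewrite !(big_ord_recr, big_ord0) /= ?expr0 ?expr1 ?invr1
             !(mulr0, mulr1, add0r, addr0).
Qed.

(** The entries are [0], [1], [1 + 1/q] and [1 + 1/q + 1/q^2]; outside the interval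
    [-1 < q <= 0] already [1 + 1/q] is nonnegative.  At [q = -1] it vanishes, so
    only the entries [1] of adjacent vertices serve below for irreducibility. *)
Lemma q_distance_ge0 : q != 0 -> ~~ (-1 < q <= 0) -> forall i j, 0 <= Dq i j.
Proof.
move=> q0 qN i j.
have be_ge0 : 0 <= 1 + q^-1.
  case: (ltrgt0P q) => [q_gt0|q_lt0|q_eq0]; last by rewrite q_eq0 eqxx in q0.
    by rewrite addr_ge0 // invr_ge0 ltW.
  move: qN; rewrite (ltW q_lt0) andbT -leNgt => q_le.
  have -> : 1 + q^-1 = q^-1 * (q + 1) by field.
  by rewrite mulr_le0 ?invr_le0 ?(ltW q_lt0) //; lra.
have ga_ge0 : 0 <= 1 + q^-1 + q ^- 2.
  by rewrite addr_ge0 // invr_ge0 sqr_ge0.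
by rewrite q_distance_mxE !mxE !addr_ge0 ?mulr_ge0.
Qed.

Lemma q_distance_adj x y :
  adj x y -> Dq (enum_rank x) (enum_rank y) = 1.
Proof.
rewrite -dist_eq1 // mxE !enum_rankK => /eqP->.
by rewrite big_ord_recr big_ord0 /= add0r expr0 invr1.
Qed.

Lemma q_distance_connect i j : connect [rel i j | 0 < Dq j i] i j.
Proof.
rewrite -(enum_valK i) -(enum_valK j).
have /connectP[p path_p ->] := G_conn (enum_val i) (enum_val j).
apply/connectP; exists (map enum_rank p); last by rewrite last_map.
apply: homo_path path_p => x y xy /=.
by rewrite q_distance_adj ?ltr01 // adj_sym.
Qed.

(** By Perron's argument [v] is constant, and then its coordinate sum can vanish
    only if [v] does. *)
Lemma perron_eigenvalue_simple (lambda : R) (v : 'rV_n) :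
    q != 0 -> ~~ (-1 < q <= 0) ->
    (const_mx 1 : 'rV_n) *m Dq = lambda *: const_mx 1 ->
    v *m Dq = lambda *: v -> v *m (const_mx 1 : 'M_n) = 0 ->
  v = 0.
Proof.
move=> q0 qN D1 vD vJ.
have v_const := perron_constant (q_distance_ge0 q0 qN) D1 q_distance_connect vD.
apply/rowP => i; move/rowP: vJ => /(_ i); rewrite !mxE.
rewrite (eq_bigr (fun=> v 0 i)) => [|j _]; last by rewrite mxE mulr1 (v_const j i).
rewrite sumr_const card_ord => /eqP; rewrite mulrn_eq0 => /orP[|/eqP//].
by rewrite -leqn0 leqNgt card_gt0.
Qed.

End QDistance.

(** * The spectrum of the q-distance matrix *)

Section QSpectrum.
Variables (R : realType) (G : sgraph) (a b c : nat -> nat) (q : R).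
Hypotheses (G_conn : connected_graph G) (G_diam : diameter G = 3%N)
  (abc : @intersection_numbers G a b c) (q_neq0 : q != 0).
Local Notation n := #|G|.
Local Notation A := (adjacency_mx R G).
Local Notation Dq := (q_distance_mx G q).
Local Notation k := ((b 0)%:R : R).
Local Notation a1 := ((a 1)%:R : R).
Local Notation b2 := ((b 2)%:R : R).
Local Notation c2 := ((c 2)%:R : R).
Local Notation c3 := ((c 3)%:R : R).
Local Notation J := (const_mx 1 : 'M[R]_n).

(* Coefficients of [J], [A * A], [A] and [1] in [Dq], obtained by eliminating
   [A2] and [A3] from [A + (1 + 1/q) A2 + (1 + 1/q + 1/q^2) A3]. *)
Let p3 : R := 1 + q^-1 + q ^- 2.
Let p2 : R := - (q ^- 2 / c2).
Let p1 : R := - (q^-1 + q ^- 2) - a1 * p2.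
Let p0 : R := - p3 - k * p2.

Definition q_eigenvalue : R -> R := nontrivial_value p0 p1 p2.
Definition q_trivial_eigenvalue : R := trivial_value n k p3 p0 p1 p2.

Lemma c2_neq0 : c2 != 0.
Proof. by rewrite pnatr_eq0 -lt0n (c2_gt0 G_conn G_diam abc). Qed.

Lemma q_distance_quadratic : Dq = quadratic_mx A p3 p0 p1 p2.
Proof.
have A3E : dist_mx R G 3 = J - 1%:M - A - dist_mx R G 2.
  rewrite -(dist_mx_sum R G_conn G_diam).
  by apply/matrixP => i j; rewrite !mxE; ring.
rewrite q_distance_mxE // A3E /quadratic_mx (dist_mx1_mulA R G_conn G_diam abc).
apply/matrixP => i j; rewrite !mxE -[k *+ _]mulr_natr.
move: (adj _ _)%:R (dist _ _ == 2)%:R (i == j)%:R => x y z.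
rewrite /p0 /p1 /p2 /p3; field.
by rewrite q_neq0 c2_neq0.
Qed.

Lemma a3E : (a 3)%:R = k - c3.
Proof. by rewrite -(valency_split G_conn G_diam abc) natrD addrK. Qed.

Lemma adjacency_cubic_array :
  A *m A *m A + (c2 - a1 - (k - c3) + b2) *: (A *m A)
    + (c2 - k - (k - c3) * (c2 - a1) - a1 * b2) *: A
    + (- (k - c3) * (c2 - k) - k * b2) *: 1%:M = (c2 * c3) *: J.
Proof.
have -> : c2 * c3 = c2 * (k - (k - c3)) by ring.
rewrite -a3E; apply: (adjacency_cubic (A2 := dist_mx R G 2) (A3 := dist_mx R G 3)).
- exact: (dist_mx1_mulA R G_conn G_diam abc).
- exact: (dist_mx3_mulA R G_conn G_diam abc).
- exact: (dist_mx_sum R G_conn G_diam).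
- exact: (adjacency_Jmul R G_conn abc).
Qed.

Section Eigenvalues.
Variables x y z : R.
Hypotheses (xy : x != y) (xz : x != z) (yz : y != z)
  (eigA : {in [:: x; y; z], forall theta, eigenvalue A theta /\ theta != k}).

(** An eigenvector for a nontrivial eigenvalue is killed by [J], so the cubic
    relation for [A] makes the eigenvalue a root of the cubic. *)
Lemma eigenvalue_vieta :
  [/\ c2 - a1 - (k - c3) + b2 = - (x + y + z),
      c2 - k - (k - c3) * (c2 - a1) - a1 * b2 = x * y + x * z + y * z
    & - (k - c3) * (c2 - k) - k * b2 = - (x * y * z)].
Proof.
apply: cubic_vieta => // u /eigA[/eigenvalueP[v vA v0] uk].
have vJ := eigenvector_sum0 (adjacency_mulJ R G_conn abc) uk vA.
have /(congr1 (mulmx v)) := adjacency_cubic_array.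
rewrite !mulmxDr -!scalemxAr mulmx1 vJ scaler0 !mulmxA vA -!scalemxAl vA.
rewrite -!scalemxAl vA !scalerA -!scalerDl => /eqP.
by rewrite scaler_eq0 (negPf v0) orbF => /eqP <-; ring.
Qed.

(** The Hoffman polynomial of the graph, up to its normalization. *)
Lemma hoffman_identity :
  (A - x%:M) *m (A - y%:M) *m (A - z%:M) = (c2 * c3) *: J.
Proof.
rewrite -adjacency_cubic_array; have [-> -> ->] := eigenvalue_vieta.
rewrite -[x%:M]scalemx1 -[y%:M]scalemx1 -[z%:M]scalemx1.
rewrite !(mulmxBl, mulmxBr, mulmx1, mul1mx, =^~ scalemxAl, =^~ scalemxAr).
move: (A *m A) (A *m A *m A) => W2 W3.
apply/matrixP => i j; rewrite !mxE.
by move: (adj _ _)%:R (i == j)%:R => u v; ring.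
Qed.

Lemma q_distance_spectrum t : eigenvalue Dq t =
  (t \in q_trivial_eigenvalue :: [seq q_eigenvalue theta | theta <- [:: x; y; z]]).
Proof.
rewrite q_distance_quadratic.
apply: (quadratic_spectrum _ _ _ _ _ _ _ eigA hoffman_identity).
- exact: (adjacency_mulJ R G_conn abc).
- exact: (adjacency_Jmul R G_conn abc).
- exact: card_gt0 G_diam.
Qed.

(** As [q_eigenvalue] is a quadratic polynomial, the difference of its values at
    [x] and [y] is divisible by [x - y]; up to [q^-2] the other factor is affine
    in [q] and vanishes at [(a1 - c2 - x - y) / c2], which the sum of the three
    eigenvalues expresses through [z]. *)
Lemma q_eigenvalue_eq :
  (q_eigenvalue x == q_eigenvalue y) = (q == (z - (k - c3) + b2) / c2).
Proof.
have [sum_xyz _ _] := eigenvalue_vieta; have c20 := c2_neq0.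
have -> : z - (k - c3) + b2 = a1 - c2 - x - y.
  apply/eqP; rewrite -subr_eq0; apply/eqP.
  by move: sum_xyz => /eqP; rewrite -subr_eq0 => /eqP <-; ring.
rewrite -subr_eq0 -[RHS]subr_eq0.
have -> : q_eigenvalue x - q_eigenvalue y =
    - (x - y) * q ^- 2 * (q - (a1 - c2 - x - y) / c2).
  rewrite /q_eigenvalue /nontrivial_value /p0 /p1 /p2 /p3; field.
  by rewrite q_neq0 c20.
rewrite !mulf_eq0 oppr_eq0 [x - y == 0]subr_eq0 (negPf xy).
by rewrite invr_eq0 expf_eq0 (negPf q_neq0).
Qed.

End Eigenvalues.

(** If the two values agreed, an eigenvector of [A] for [theta] would be a second
    eigenvector of [Dq] for its Perron eigenvalue. *)
Lemma q_trivial_eigenvalue_simple theta :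
    ~~ (-1 < q <= 0) -> eigenvalue A theta -> theta != k ->
  q_trivial_eigenvalue != q_eigenvalue theta.
Proof.
move=> qN /eigenvalueP[v vA v0] thk; apply: contra v0 => /eqP E.
have AJ := adjacency_mulJ R G_conn abc; have JA := adjacency_Jmul R G_conn abc.
have vJ := eigenvector_sum0 AJ thk vA.
apply/eqP; apply: (perron_eigenvalue_simple (lambda := q_trivial_eigenvalue)
  G_conn G_diam q_neq0 qN _ _ vJ).
  rewrite q_distance_quadratic.
  exact: const_row_mul (card_gt0 G_diam) (quadratic_Jmul _ _ _ _ JA).
by rewrite q_distance_quadratic E; apply: quadratic_eigenvector.
Qed.

End QSpectrum.

(** * Counting the distinct values *)

(** The hypotheses say that a coincidence among the [x_i] means that [q] is
    the [u_l] of the remaining index; the [u_l] being distinct, two coincidences cannot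
    occur together. *)
Lemma size_undup3 (T U : eqType) (x1 x2 x3 : T) (q u1 u2 u3 : U) :
    uniq [:: u1; u2; u3] ->
    (x1 == x2) = (q == u3) -> (x1 == x3) = (q == u2) -> (x2 == x3) = (q == u1) ->
  size (undup [:: x1; x2; x3]) = if q \in [:: u1; u2; u3] then 2%N else 3%N.
Proof.
rewrite /= !inE negb_or !andbT => /andP[/andP[u12 u13] u23] -> -> ->.
have [q1|] := eqVneq q u1; first by rewrite q1 (negPf u12) (negPf u13).
have [q2|] := eqVneq q u2; first by rewrite q2 (negPf u23).
by have [] := eqVneq q u3.
Qed.

Theorem corollary3p6 (R : realType) (G : sgraph) (k b1 b2 c2 c3 : nat)
    (theta1 theta2 theta3 q : R)
    (G_dr : distance_regular G)
    (G_diam : diameter G = 3%N)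
    (G_array : intersection_array G [:: k; b1; b2] [:: 1%N; c2; c3])
    (G_eig : distinct_eigenvalues (adjacency_mx R G)
               [:: k%:R; theta1; theta2; theta3])
    (k_gt : theta1 < k%:R) (theta1_gt : theta2 < theta1)
    (theta2_gt : theta3 < theta2)
    (q_neq0 : q != 0) :
  let a3 : R := k%:R - c3%:R in
  let q_ (theta : R) : R := (theta - a3 + b2%:R) / c2%:R in
  let Q : seq R := [:: q_ theta1; q_ theta2; q_ theta3] in
  let Dq := q_distance_mx G q in
  [/\ q \notin Q -> ~~ (-1 < q <= 0) ->
        exists s, distinct_eigenvalues Dq s /\ size s = 4%N,
      q \notin Q -> -1 < q < 0 ->
        exists s, distinct_eigenvalues Dq s /\ (3 <= size s)%N,
      q \in Q -> ~~ (-1 < q <= 0) ->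
        exists s, distinct_eigenvalues Dq s /\ size s = 3%N
    & q \in Q -> -1 < q < 0 ->
        exists s, distinct_eigenvalues Dq s /\ (2 <= size s <= 3)%N].
Proof.
move=> a3 q_ Q Dq.
have [a [b [c [abc]]]] := G_array; rewrite G_diam /mkseq /=.
move=> [Ek _ Eb2] [_ Ec2 Ec3].
have q_E theta :
    q_ theta = (theta - ((b 0)%:R - (c 3)%:R) + (b 2)%:R) / (c 2)%:R.
  by rewrite /q_ /a3 Ek Eb2 Ec2 Ec3.
rewrite Ek in G_eig k_gt.
have G_conn : connected_graph G by case: G_dr.
case: G_eig => _ eigA; have theta3_lt := lt_trans theta2_gt theta1_gt.
have eig theta : theta \in [:: theta1; theta2; theta3] ->
    eigenvalue (adjacency_mx R G) theta /\ theta != (b 0)%:R.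
  move=> th; rewrite eigA in_cons th orbT; split=> //.
  have : theta <= theta1.
    move: th; rewrite !inE => /or3P[]/eqP->; first by [].
      exact: ltW.
    exact: ltW.
  by move=> le1; rewrite lt_eqF // (le_lt_trans le1).
(* Lemma [q_eigenvalue_eq] compares the first two of the three eigenvalues, hence
   the reorderings. *)
have eig132 : {in [:: theta1; theta3; theta2], forall theta,
    eigenvalue (adjacency_mx R G) theta /\ theta != (b 0)%:R}.
  by move=> th th_in; apply: eig; move: th_in; rewrite !inE => /or3P[]->; rewrite ?orbT.
have eig231 : {in [:: theta2; theta3; theta1], forall theta,
    eigenvalue (adjacency_mx R G) theta /\ theta != (b 0)%:R}.
  by move=> th th_in; apply: eig; move: th_in; rewrite !inE => /or3P[]->; rewrite ?orbT.
have n12 : theta1 != theta2 by rewrite gt_eqF.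
have n13 : theta1 != theta3 by rewrite gt_eqF.
have n23 : theta2 != theta3 by rewrite gt_eqF.
pose f := q_eigenvalue a b c q; pose lambda := q_trivial_eigenvalue G a b c q.
pose s := lambda :: [:: f theta1; f theta2; f theta3].
have s_spec : distinct_eigenvalues Dq (undup s).
  split=> [|t]; first exact: undup_uniq.
  by rewrite mem_undup (q_distance_spectrum G_conn G_diam abc q_neq0 n12 n13 n23 eig).
have c2_neq : (c 2)%:R != 0 :> R := c2_neq0 R G_conn G_diam abc.
have Q_uniq : uniq Q.
  have q_inj : injective q_.
    by move=> x y; rewrite !q_E => /(divIf c2_neq)/addIr/addIr.
  rewrite -[Q]/(map q_ [:: theta1; theta2; theta3]) (map_inj_uniq q_inj).
  by rewrite /= !inE negb_or n12 n13 n23.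
have size_f : size (undup [:: f theta1; f theta2; f theta3]) =
    if q \in Q then 2%N else 3%N.
  apply: size_undup3 => //.
  - by rewrite q_E (q_eigenvalue_eq G_conn G_diam abc q_neq0 n12 n13 n23 eig).
  - rewrite q_E.
    by apply: (q_eigenvalue_eq G_conn G_diam abc q_neq0 n13 n12 _ eig132); rewrite eq_sym.
  - rewrite q_E.
    by apply: (q_eigenvalue_eq G_conn G_diam abc q_neq0 n23 _ _ eig231); rewrite eq_sym.
have size_s : size (undup s) =
    ((lambda \notin behead s) + if q \in Q then 2%N else 3%N)%N.
  by rewrite -size_f [undup s]/=; case: ifP.
have lambda_new : ~~ (-1 < q <= 0) -> lambda \notin behead s.
  move=> qN; rewrite -[behead s]/(map f [:: theta1; theta2; theta3]).
  apply/mapP => -[theta /eig[eig_theta thk] /eqP].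
  by apply/negP; apply: q_trivial_eigenvalue_simple eig_theta thk.
split=> qQ qI; exists (undup s); split=> //; rewrite size_s.
- by rewrite lambda_new // (negPf qQ).
- by rewrite (negPf qQ) leq_addl.
- by rewrite lambda_new // qQ.
- by rewrite qQ; case: (_ \notin _).
Qed.
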